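(* Let $M$ be a monoid acting idealistically, outward properly and coboundedly by isometric embeddings on a geodesic semimetric space $X$. Then $M$ is finitely generated and quasi-isometric to $X$.
   Context: Let $\mathbb{R}^\infty = \mathbb{R}^{\ge 0}\cup\{\infty\}$ with the obvious order, addition and multiplication ($0\cdot\infty$ undefined). A semimetric on a set $X$ is a function $d:X\times X\to\mathbb{R}^\infty$ with (i) $d(x,y)=0$ if and only if $x=y$, and (ii) $d(x,z)\le d(x,y)+d(y,z)$ for all $x,y,z$ (symmetry is not required). A semimetric space is a set equipped with a semimetric. A point $x_0\in X$ is a basepoint if $d(x_0,y)\neq\infty$ for all $y\in X$. For $A,B\subseteq X$, $d(A,B)=\inf\{d(a,b): a\in A, b\in B\}$. A path of length $n\in\mathbb{R}$ from $x$ to $y$ is a map $p:[0,n]\to X$ with $p(0)=x$, $p(n)=y$ and $d(p(a),p(b))\le b-a$ for all $0\le a\le b\le n$. If $d(x,y)\ne\infty$, a geodesic from $x$ to $y$ is a path of length $d(x,y)$ from $x$ to $y$. $X$ is geodesic if for all $x,y\in X$ with $d(x,y)\neq\infty$ there is at least one geodesic from $x$ to $y$. For $x_0\in X$ and real $r\ge 0$, the out-ball of radius $r$ based at $x_0$ is $\{y: d(x_0,y)\le r\}$, the in-ball is $\{y: d(y,x_0)\le r\}$, and the strong ball is their intersection. A map $f:X\to Y$ of semimetric spaces is an isometric embedding if $d(f(x),f(y))=d(x,y)$ for all $x,y$. It is a quasi-isometry if there are constants $1\le\lambda<\infty$, $0<\epsilon<\infty$, $1\le\mu<\infty$ such that $\frac1\lambda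 d(x,y)-\epsilon\le d(f(x),f(y))\le\lambda d(x,y)+\epsilon$ for all $x,y\in X$, and every point of $Y$ lies in the strong ball of radius $\mu$ around some point of $f(X)$. $X$ and $Y$ are quasi-isometric if there is a quasi-isometry $X\to Y$ (this is an equivalence relation). Let a monoid $M$ act (on the left) by isometric embeddings on a semimetric space $X$ (so the identity of $M$ acts as the identity map and each $m\in M$ acts as an isometric embedding $X\to X$). The action is cobounded if there is a strong ball $B$ of finite radius such that the translates $mB$, $m\in M$, cover $X$. It is outward proper if for every out-ball $B$ of finite radius the set $\{m\in M: d(B,mB)=0\}$ is finite. It is idealistic at a basepoint $x_0$ if for all $m,n\in M$, $d(mx_0,nx_0)<\infty$ implies $nM\subseteq mM$; it is idealistic if it is idealistic at some basepoint. If $M$ is a monoid generated by a finite set $S$, it is a semimetric space under $d_S(x,y)$ = shortest length of a word $w$ over $S$ with $xw=y$ in $M$, or $\infty$ if there is none. Its quasi-isometry type does not depend on the choice of finite generating set $S$; ''$M$ is quasi-isometric to $X$'' means that $(M,d_S)$ is quasi-isometric to $X$ for some (equivalently any) finite generating set $S$. *)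

(* Defs.v *)
From HB Require Import structures.
From mathcomp Require Import all_boot all_order all_algebra.
From mathcomp Require Import all_classical all_reals ereal.

Set Implicit Arguments.
Unset Strict Implicit.
Unset Printing Implicit Defensive.

Import Order.TTheory GRing.Theory Num.Theory.

Local Open Scope classical_set_scope.
Local Open Scope ring_scope.
Local Open Scope ereal_scope.

Record semimetric (R : realType) (X : Type) : Type := Semimetric {
  dist :> X -> X -> \bar R ;
  dist_ge0 : forall x y, 0 <= dist x y ;
  dist_eq0 : forall x y, dist x y = 0 <-> x = y ;
  dist_triangle : forall x y z, dist x z <= dist x y + dist y z
}.

Section Semimetric.
Context {R : realType} {X : Type} (d : semimetric R X).

Definition basepoint (x0 : X) : Prop := forall y, d x0 y != +oo.

Definition set_dist (A B : set X) : \bar R :=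
  ereal_inf [set d a b | a in A & b in B].

Definition out_ball (x : X) (r : R) : set X := [set y | d x y <= r%:E].
Definition in_ball (x : X) (r : R) : set X := [set y | d y x <= r%:E].
Definition strong_ball (x : X) (r : R) : set X := out_ball x r `&` in_ball x r.

(* A map [0, n] -> X is given by a function on all of R; its values outside
   [0, n] are unconstrained and irrelevant. *)
Definition is_path (n : R) (x y : X) (p : R -> X) : Prop :=
  [/\ (0 <= n)%R, p 0%R = x, p n = y &
      forall a b : R, (0 <= a)%R -> (a <= b)%R -> (b <= n)%R ->
        d (p a) (p b) <= (b - a)%:E].

Definition is_geodesic (x y : X) (p : R -> X) : Prop :=
  d x y != +oo /\ is_path (fine (d x y)) x y p.

Definition geodesic_space : Prop :=
  forall x y, d x y != +oo -> exists p, is_geodesic x y p.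

End Semimetric.

Section Maps.
Context {R : realType} {X Y : Type} (dX : semimetric R X) (dY : semimetric R Y).

Definition isometric_embedding (f : X -> Y) : Prop :=
  forall x y, dY (f x) (f y) = dX x y.

Definition quasi_isometry (f : X -> Y) : Prop :=
  exists lambda eps mu : R,
    [/\ (1 <= lambda)%R, (0 < eps)%R, (1 <= mu)%R,
        forall x y, (lambda^-1)%:E * dX x y - eps%:E <= dY (f x) (f y) /\
                    dY (f x) (f y) <= lambda%:E * dX x y + eps%:E &
        forall y, exists x, strong_ball dY (f x) mu y].

Definition quasi_isometric : Prop := exists f, quasi_isometry f.

End Maps.

Section Action.
Context {R : realType} {M : monoidType} {X : Type} (d : semimetric R X).
Variable act : M -> X -> X.

Definition acts_by_isometric_embeddings : Prop :=
  [/\ forall x, act 1%g x = x,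
      forall m n x, act (m * n)%g x = act m (act n x) &
      forall m, isometric_embedding d d (act m)].

Definition cobounded : Prop :=
  exists (x : X) (r : R), (0 <= r)%R /\
    \bigcup_(m in [set: M]) (act m @` strong_ball d x r) = [set: X].

Definition outward_proper : Prop :=
  forall (x : X) (r : R), (0 <= r)%R ->
    finite_set [set m : M |
      set_dist d (out_ball d x r) (act m @` out_ball d x r) = 0].

Definition idealistic_at (x0 : X) : Prop :=
  forall m n : M, d (act m x0) (act n x0) < +oo ->
    range (fun k => (n * k)%g) `<=` range (fun k => (m * k)%g).

Definition idealistic : Prop :=
  exists x0, basepoint d x0 /\ idealistic_at x0.

End Action.

Section WordSemimetric.
Context (R : realType) {M : monoidType} (S : set M).

Definition word_prod (w : seq M) : M := (\prod_(s <- w) s)%g.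

Definition word_from_to (x y : M) : set (seq M) :=
  [set w | [set` w] `<=` S /\ (x * word_prod w)%g = y].

(* The infimum of the empty set is +oo. *)
Definition word_dist (x y : M) : \bar R :=
  ereal_inf [set ((size w)%:R : R)%:E | w in word_from_to x y].

Lemma word_distP (x y : M) :
  (word_from_to x y = set0 /\ word_dist x y = +oo) \/
  exists2 w, word_from_to x y w & word_dist x y = ((size w)%:R : R)%:E.
Proof.
have [E0|/set0P[w0 xyw0]] := eqVneq (word_from_to x y) set0.
  by left; rewrite /word_dist E0 image_set0 ereal_inf0.
right; pose P n := `[< exists2 w, word_from_to x y w & size w = n >].
have exP : exists n, P n by exists (size w0); apply/asboolP; exists w0.
have [n /asboolP[w xyw wn] nmin] := ex_minnP exP.
exists w => //; apply/eqP; rewrite eq_le; apply/andP; split.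
  by apply: ereal_inf_lbound; exists w.
apply: le_ereal_inf_tmp => _ [v xyv <-]; rewrite lee_fin ler_nat wn.
by apply: nmin; apply/asboolP; exists v.
Qed.

Lemma word_dist_le (x y : M) (w : seq M) :
  word_from_to x y w -> word_dist x y <= ((size w)%:R : R)%:E.
Proof. by move=> xyw; apply: ereal_inf_lbound; exists w. Qed.

Lemma word_dist_ge0 (x y : M) : 0 <= word_dist x y.
Proof. by have [[_ ->]|[w _ ->]] := word_distP x y; rewrite ?leey // lee_fin. Qed.

Lemma word_dist_eq0 (x y : M) : word_dist x y = 0 <-> x = y.
Proof.
split=> [|->].
  have [[_ ->]//|[w [_ <-] ->]] := word_distP x y.
  case=> /eqP; rewrite pnatr_eq0 size_eq0 => /eqP ->.
  by rewrite /word_prod big_nil mulg1.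
apply/eqP; rewrite eq_le word_dist_ge0 andbT.
by apply: (@word_dist_le _ _ [::]); split=> //; rewrite /word_prod big_nil mulg1.
Qed.

Lemma word_dist_triangle (x y z : M) :
  word_dist x z <= word_dist x y + word_dist y z.
Proof.
have [[_ ->]|[v [Sv xvy] ->]] := word_distP x y.
  by rewrite addye ?leey // gt_eqF // (lt_le_trans _ (word_dist_ge0 y z)) ?ltNy0.
have [[_ ->]|[w [Sw ywz] ->]] := word_distP y z; first by rewrite leey.
rewrite -EFinD -natrD -size_cat; apply: word_dist_le; split.
  by move=> s /=; rewrite mem_cat => /orP[/Sv|/Sw].
by rewrite /word_prod big_cat /= mulgA -/(word_prod v) -/(word_prod w) xvy.
Qed.

Definition word_semimetric : semimetric R M :=
  Semimetric word_dist_ge0 word_dist_eq0 word_dist_triangle.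

End WordSemimetric.

Definition generates (M : monoidType) (S : set M) : Prop :=
  forall m : M, exists2 w : seq M, [set` w] `<=` S & word_prod w = m.

Definition finitely_generated (M : monoidType) : Prop :=
  exists S : set M, finite_set S /\ generates S.

Definition monoid_quasi_isometric (R : realType) (M : monoidType) (X : Type)
    (d : semimetric R X) : Prop :=
  exists S : set M,
    [/\ finite_set S, generates S & quasi_isometric (word_semimetric R S) d].

(* Main.v *)
Require Import Defs.
From mathcomp Require Import all_boot all_order all_algebra.
From mathcomp Require Import all_classical all_reals ereal.

(** Let [x0] be a basepoint witnessing idealism. Coboundedness can be recentred
at [x0], so that the orbit of [x0] is [r]-dense for strong balls. Put
[D = 2r + 1] and let [S] be the set of [s] with [d(x0, s x0) <= D], finite by
outward properness. A geodesic from [m x0] to [n x0] is followed in unit steps,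
replacing each point visited by a nearby orbit point [m_i x0]; consecutive orbit
points are at distance at most [D], so idealism gives [m_(i+1) = m_i s_i], and
[s_i] lies in [S] because [m_i] acts by an isometric embedding. Hence [S]
generates [M], [d_S(m, n) <= d(m x0, n x0) + 2], and [m |-> m x0] is a
quasi-isometry. *)

Set Implicit Arguments.
Unset Strict Implicit.
Unset Printing Implicit Defensive.

Import Order.TTheory GRing.Theory Num.Theory.

Local Open Scope classical_set_scope.
Local Open Scope ring_scope.
Local Open Scope ereal_scope.

Definition displacement_le {R : realType} {M : monoidType} {X : Type}
    (d : semimetric R X) (act : M -> X -> X) (x : X) (r : R) : set M :=
  [set s | d x (act s x) <= r%:E].

Lemma dist_refl (R : realType) (X : Type) (d : semimetric R X) (x : X) :
  d x x = 0.
Proof. by apply/dist_eq0. Qed.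

Lemma dist_le_trans (R : realType) (X : Type) (d : semimetric R X) (x y z : X)
    (a b : R) :
  d x y <= a%:E -> d y z <= b%:E -> d x z <= (a + b)%:E.
Proof.
by move=> xy yz; rewrite EFinD (le_trans (dist_triangle d x y z)) ?leeD.
Qed.

Lemma dist_finP (R : realType) (X : Type) (d : semimetric R X) (x y : X) :
  d x y < +oo -> exists2 r : R, (0 <= r)%R & d x y = r%:E.
Proof.
have := dist_ge0 d x y.
by case: (d x y) => // r; rewrite lee_fin => r0 _; exists r.
Qed.

Lemma set_dist_eq0 (R : realType) (X : Type) (d : semimetric R X) (A B : set X)
    (x : X) :
  A x -> B x -> set_dist d A B = 0.
Proof.
move=> Ax Bx; apply/eqP; rewrite eq_le; apply/andP; split.
  by apply: ereal_inf_lbound; exists x => //; exists x => //; exact: dist_refl.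
by apply: le_ereal_inf_tmp => _ [a _ [b _ <-]]; exact: dist_ge0.
Qed.

(** If [s] moves [x] by at most [r], then [act s x] lies both in the out-ball around [x] and in its
    translate by [s], so these two sets are at distance 0. *)
Lemma finite_displacement_le (R : realType) (M : monoidType) (X : Type)
    (d : semimetric R X) (act : M -> X -> X) (x : X) (r : R) :
  outward_proper d act -> (0 <= r)%R -> finite_set (displacement_le d act x r).
Proof.
move=> proper r0; apply: sub_finite_set (proper x r r0) => s sr /=.
apply: (@set_dist_eq0 _ _ _ _ _ (act s x)) => //.
by exists x => //; rewrite /out_ball /= dist_refl lee_fin.
Qed.

(** The issue is asymmetry: the basepoint only gives [d x0 x] finite. For the way back, some
    translate [act m x] is close to [x0], from which [act m x0] is at finite distance; cancelling
    the isometric embedding [m] bounds [d x x0]. *)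
Lemma cobounded_basepoint (R : realType) (M : monoidType) (X : Type)
    (d : semimetric R X) (act : M -> X -> X) (x0 : X) :
  acts_by_isometric_embeddings d act -> basepoint d x0 -> cobounded d act ->
  exists r : R, (1 <= r)%R /\
    forall y, exists m, strong_ball d (act m x0) r y.
Proof.
move=> [_ _ iso] base [x [r [r0 cover]]].
have near y : exists m, strong_ball d (act m x) r y.
  have : [set: X] y by [].
  rewrite -cover => -[m _ [b [xb bx] <-]]; exists m.
  by split; rewrite /out_ball /in_ball /= iso.
have base_lt y : d x0 y < +oo by rewrite ltey.
have [a a0 x0x] := dist_finP (base_lt x).
have [m [mx_x0 _]] := near x0.
have xx0oo : d x x0 < +oo.
  have [c _ x0m] := dist_finP (base_lt (act m x0)).
  have mx0 : d x0 (act m x0) <= c%:E by rewrite x0m.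
  by rewrite -(iso m) (le_lt_trans (dist_le_trans mx_x0 mx0)) ?ltry.
have [b b0 xx0] := dist_finP xx0oo.
(* Passing from [x] to [x0] costs [a] one way and [b] the other; the summand 1 makes the radius
   admissible as the constant [mu]. *)
exists (1 + a + b + r)%R; split.
  by rewrite -!addrA lerDl !addr_ge0.
move=> y; have [n [nxy ynx]] := near y; exists n.
have x0_x : d (act n x0) (act n x) <= a%:E by rewrite iso x0x.
have x_x0 : d (act n x) (act n x0) <= b%:E by rewrite iso xx0.
split.
  apply: le_trans (dist_le_trans x0_x nxy) _; rewrite lee_fin lerD2r.
  by rewrite addrAC lerDr addr_ge0.
apply: le_trans (dist_le_trans ynx x_x0) _; rewrite lee_fin addrC lerD2r.
by rewrite lerDr addr_ge0.
Qed.

Lemma idealistic_factor (R : realType) (M : monoidType) (X : Type)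
    (d : semimetric R X) (act : M -> X -> X) (x0 : X) (r : R) (m n : M) :
  acts_by_isometric_embeddings d act -> idealistic_at d act x0 ->
  d (act m x0) (act n x0) <= r%:E ->
  exists2 s, displacement_le d act x0 r s & (m * s)%g = n.
Proof.
move=> [_ actM iso] ideal mn.
(* Idealism gives the inclusion of nM in mM, applied to [n] as [n * 1]. *)
have [|s _ msn] := ideal m n (le_lt_trans mn (ltry r)) n.
  by exists 1%g => //; rewrite mulg1.
by exists s => //; rewrite /displacement_le /= -(iso m) -actM msn.
Qed.

Lemma word_from_to_cons (M : monoidType) (S : set M) (m n s : M) (w : seq M) :
  S s -> word_from_to S (m * s)%g n w -> word_from_to S m n (s :: w).
Proof.
move=> Ss [Sw <-]; split; last by rewrite /word_prod big_cons mulgA.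
by move=> t /=; rewrite inE => /orP[/eqP->|/Sw].
Qed.

Lemma word_from_to_nil (M : monoidType) (S : set M) (m : M) :
  word_from_to S m m [::].
Proof. by split=> //; rewrite /word_prod big_nil mulg1. Qed.

(** Induction on [k], a bound on the unit steps left after time [t], with [act m x0] the orbit point
    shadowing [p t]. A letter costs [r] to reach the path, 1 along it and [r] back to the orbit. The
    extra letter is needed because even at [t = L] the shadow may differ from the endpoint. *)
Lemma word_along_path (R : realType) (M : monoidType) (X : Type)
    (d : semimetric R X) (act : M -> X -> X) (x0 : X) (r L : R) (p : R -> X)
    (x : X) (n : M) (k : nat) (m : M) (t : R) :
  acts_by_isometric_embeddings d act -> idealistic_at d act x0 ->
  (0 <= r)%R -> (forall y, exists l, strong_ball d (act l x0) r y) ->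
  is_path d L x (act n x0) p ->
  (0 <= t)%R -> (t <= L)%R -> (L <= t + k%:R)%R ->
  d (act m x0) (p t) <= r%:E ->
  exists2 w, word_from_to (displacement_le d act x0 (r + 1 + r)) m n w &
    (size w <= k.+1)%N.
Proof.
move=> acts ideal r0 dense [_ _ pL plip].
(* Within one unit of the end no new shadow is chosen: the endpoint is already in the orbit, and
   [r + 1] suffices. *)
have last_step l u : (0 <= u)%R -> (u <= L)%R -> (L <= u + 1)%R ->
    d (act l x0) (p u) <= r%:E ->
    exists2 s, displacement_le d act x0 (r + 1 + r) s & (l * s)%g = n.
  move=> u0 uL Lu1 lpu; apply: idealistic_factor => //; rewrite -pL.
  apply: le_trans (dist_le_trans lpu (plip _ _ u0 uL _)) _ => //.
  by rewrite lee_fin -addrA lerD2l (le_trans (y := 1%R)) ?lerDl // lerBlDl.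
elim: k m t => [|k IH] m t t0 tL Ltk mpt.
  have [|s Ss <-] := last_step m t t0 tL _ mpt.
    by rewrite (le_trans Ltk) // lerD2l.
  by exists [:: s] => //; exact/word_from_to_cons/word_from_to_nil.
have [Lt1|t1L] := leP L (t + 1)%R.
  have [s Ss <-] := last_step m t t0 tL Lt1 mpt.
  by exists [:: s] => //; exact/word_from_to_cons/word_from_to_nil.
have [l [lpt ptl]] := dense (p (t + 1)%R).
have pt1 : d (p t) (p (t + 1)%R) <= 1%:E.
  apply: le_trans (plip _ _ t0 _ (ltW t1L)) _; first by rewrite lerDl.
  by rewrite addrAC subrr add0r.
have [s Ss sl] :=
  idealistic_factor acts ideal (dist_le_trans (dist_le_trans mpt pt1) ptl).
have [||w lw wk] := IH l (t + 1)%R _ (ltW t1L) _ lpt; first by rewrite addr_ge0.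
  by rewrite -addrA nat1r.
by exists (s :: w) => //; apply: word_from_to_cons; rewrite ?sl.
Qed.

Lemma word_of_finite_dist (R : realType) (M : monoidType) (X : Type)
    (d : semimetric R X) (act : M -> X -> X) (x0 : X) (r : R) (m n : M) :
  geodesic_space d -> acts_by_isometric_embeddings d act ->
  idealistic_at d act x0 -> (0 <= r)%R ->
  (forall y, exists l, strong_ball d (act l x0) r y) ->
  d (act m x0) (act n x0) < +oo ->
  exists2 w, word_from_to (displacement_le d act x0 (r + 1 + r)) m n w &
    ((size w)%:R : R)%:E <= d (act m x0) (act n x0) + 2%:E.
Proof.
move=> geod acts ideal r0 dense mnoo.
have [|p [_]] := geod (act m x0) (act n x0); first by rewrite -ltey.
have [L L0 ->] := dist_finP mnoo; rewrite /= => path.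
have [_ p0 _ _] := path.
(* With [k] equal to the integer part of [L] plus 1, the word has at most that integer part plus 2
   letters, whence the additive constant 2. *)
have [||||w mnw wk] := @word_along_path _ _ _ _ _ _ _ _ _ _ _
    (Num.truncn L).+1 m 0%R acts ideal r0 dense path => //.
- by rewrite add0r ltW // truncnS_gt.
- by rewrite p0 dist_refl lee_fin.
exists w => //; rewrite -EFinD lee_fin.
apply: le_trans (_ : ((Num.truncn L).+2%:R <= _)%R); first by rewrite ler_nat.
by rewrite -addn2 natrD lerD2r truncn_le.
Qed.

(** Each prefix acts by an isometric embedding, so appending a letter moves the orbit point by at
    most [r]. *)
Lemma dist_le_word (R : realType) (M : monoidType) (X : Type)
    (d : semimetric R X) (act : M -> X -> X) (x : X) (r : R) (m n : M)
    (w : seq M) :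
  acts_by_isometric_embeddings d act ->
  word_from_to (displacement_le d act x r) m n w ->
  d (act m x) (act n x) <= (r * (size w)%:R)%:E.
Proof.
move=> [_ actM iso]; elim: w m => [|s w IH] m [Sw].
  by rewrite /word_prod big_nil mulg1 => <-; rewrite dist_refl mulr0.
rewrite /word_prod big_cons mulgA => msw.
have Ss : d (act m x) (act (m * s)%g x) <= r%:E.
  by rewrite actM iso; apply: Sw; rewrite /= mem_head.
rewrite /= -natr1 mulrDr mulr1 addrC; apply: dist_le_trans Ss (IH _ _).
by split=> // t tw; apply: Sw; rewrite /= inE [t \in w]tw orbT.
Qed.

Theorem theorem4p1 (R : realType) (M : monoidType) (X : Type)
    (d : semimetric R X) (act : M -> X -> X) :
  geodesic_space d ->
  acts_by_isometric_embeddings d act ->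
  idealistic d act -> outward_proper d act -> cobounded d act ->
  finitely_generated M /\ monoid_quasi_isometric M d.
Proof.
move=> geod acts [x0 [base ideal]] proper cob.
have [r [r1 dense]] := cobounded_basepoint acts base cob.
have r0 : (0 <= r)%R by exact: le_trans r1.
pose D := (r + 1 + r)%R; pose S := displacement_le d act x0 D.
have D1 : (1 <= D)%R by rewrite /D -addrA ler_wpDr // addr_ge0.
have D0 : (0 < D)%R by exact: lt_le_trans D1.
have finS : finite_set S by apply: finite_displacement_le => //; exact: ltW.
have word m n := @word_of_finite_dist _ _ _ _ _ _ _ m n geod acts ideal r0 dense.
have genS : generates S.
  (* A word from 1 to [m] exists since [x0], being a basepoint, is at finite distance from
     [act m x0]. *)
  move=> m; have [|w [Sw]] := word 1%g m; last by rewrite mul1g; exists w.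
  by have [act1 _ _] := acts; rewrite act1 ltey.
split; first by exists S.
exists S; split=> //; exists (fun m => act m x0); exists D, 2%R, r.
split=> // m n; split.
(* The lower bound holds even with factor 1, which [D^-1] does not exceed; it is trivial at infinite
   orbit distance. *)
- have [mnoo|] := ltP (d (act m x0) (act n x0)) +oo; last first.
    by rewrite leye_eq => /eqP->; rewrite leey.
  have [w mnw wle] := word m n mnoo.
  rewrite leeBlDr //; apply: le_trans wle.
  apply: le_trans (_ : word_semimetric R S m n <= _); last exact: word_dist_le.
  rewrite -[leRHS]mul1e lee_wpmul2r ?dist_ge0 // lee_fin.
  by rewrite invf_le1.
(* Without a word from [m] to [n] the upper bound is infinite; otherwise a shortest word costs at
   most [D] per letter. *)
- rewrite /=; have [[_ ->]|[w mnw ->]] := word_distP R S m n.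
    by rewrite gt0_muley ?lte_fin // addye // leey.
  rewrite -EFinM; apply: le_trans (dist_le_word acts mnw) _.
  by rewrite -EFinD lee_fin lerDl.
Qed.
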